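(* Let $\mathcal{H}=\mathcal{H}(\Omega)$ be a reproducing kernel Hilbert space, let $\sigma$ be a symmetric mean with interpolation path $\sigma_t$, $t\in[0,1]$, and let $A\in B(\mathcal{H})$. Then for $p\ge1$ $$\|A\|^p_{ber_{\sigma_t}}\le\mathrm{ber}^{\frac p2}\left(|A|^2+|A^*|^2\right).$$
   Context: A reproducing kernel Hilbert space $\mathcal{H}=\mathcal{H}(\Omega)$ on a nonempty set $\Omega$ is a Hilbert space of complex-valued functions on $\Omega$ whose point evaluations are bounded; $k_\lambda\in\mathcal H$ is the reproducing kernel at $\lambda\in\Omega$ (so $f(\lambda)=\langle f,k_\lambda\rangle$ for all $f\in\mathcal H$), and $\hat k_\lambda=k_\lambda/\|k_\lambda\|$ is the normalized reproducing kernel (implicitly $k_\lambda\ne 0$ for all $\lambda$). $B(\mathcal H)$ is the algebra of bounded linear operators on $\mathcal H$; $|A|=(A^*A)^{1/2}$. A mean is a function $\sigma:[0,\infty)\times[0,\infty)\to[0,\infty)$, written $a\,\sigma\, b=\sigma(a,b)$, such that: $\sigma(a,b)\ge 0$; $a\le b$ implies $a\le a\,\sigma\, b\le b$; $\sigma$ is increasing in both variables; $\sigma(\alpha a,\alpha b)=\alpha\,\sigma(a,b)$ for $\alpha>0$; $\sigma$ is continuous. It is symmetric if $a\,\sigma\, b=b\,\sigma\, a$ for all $a,b$. An interpolation path for a symmetric mean $\sigma$ is a family of means $\sigma_t$, $t\in[0,1]$, such that: (i) $a\,\sigma_0\, b=b$, $a\,\sigma_1\, b=a$, $a\,\sigma_{1/2}\,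 b=a\,\sigma\, b$ for all $a,b\ge0$; (ii) $(a\,\sigma_t\, b)\,\sigma\,(a\,\sigma_s\, b)=a\,\sigma_{(t+s)/2}\, b$ for all $s,t\in[0,1]$; (iii) each $\sigma_t$ is increasing in each component. For $A\in B(\mathcal H)$, $t\in[0,1]$ and $p\ge1$, the $\sigma_t$-Berezin norm is $\|A\|_{ber_{\sigma_t}}=\sup_{\lambda,\mu\in\Omega}\left(|\langle A\hat k_\lambda,\hat k_\mu\rangle|^p\,\sigma_t\,|\langle A^*\hat k_\lambda,\hat k_\mu\rangle|^p\right)^{1/p}$ (the $p$ here is the $p$ of the claim). The Berezin radius is $\mathrm{ber}(A)=\sup_{\lambda\in\Omega}|\langle A\hat k_\lambda,\hat k_\lambda\rangle|$, and $\mathrm{ber}^q(A)=(\mathrm{ber}(A))^q$. *)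

(* Defs.v *)
From HB Require Import structures.
From mathcomp Require Import all_boot all_order all_algebra.
From mathcomp Require Import complex.
From mathcomp Require Import all_classical all_reals all_analysis.

Set Implicit Arguments.
Unset Strict Implicit.
Unset Printing Implicit Defensive.

Import Order.TTheory GRing.Theory Num.Theory.
Import numFieldNormedType.Exports.

Local Open Scope classical_set_scope.
Local Open Scope ring_scope.
Local Open Scope complex_scope.

(* The inner product is linear in its first argument and conjugate-linear in
   the second. *)
HB.mixin Record CompleteNormedModule_isHilbert (R : realType) H
    of CompleteNormedModule R[i] H := {
  inner : {dot H for (@Num.conj R[i])} ;
  sqr_norm_inner : forall f : H, `|f| ^+ 2 = inner f f
}.

#[short(type="hilbertType")]
HB.structure Definition Hilbert (R : realType) :=
  {H of CompleteNormedModule R[i] H & CompleteNormedModule_isHilbert R H}.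

(* Elements of H are identified with complex functions on Omega through the
   linear injection [feval]. *)
HB.mixin Record Hilbert_isRKHS (Omega : Type) (R : realType) H
    of Hilbert R H := {
  feval : H -> Omega -> R[i] ;
  feval_linear : forall (a : R[i]) (f g : H) (x : Omega),
    feval (a *: f + g) x = a * feval f x + feval g x ;
  feval_inj : injective feval ;
  feval_bounded : forall x : Omega, exists M : R, forall f : H,
    `|feval f x| <= M%:C * `|f|
}.

#[short(type="rkhsType")]
HB.structure Definition RKHS (Omega : Type) (R : realType) :=
  {H of Hilbert R H & Hilbert_isRKHS Omega R H}.

(* [`|z|] has type [R[i]]; this is the modulus as a real number. *)
Definition modulus (R : realType) (z : R[i]) : R := complex.Re `|z|.

Section Operators.
Context {R : realType} {H : hilbertType R}.
Implicit Types A B T : H -> H.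

Definition bounded_operator A : Prop :=
  linear A /\ bounded_near A (nbhs (0 : H)).

Definition is_adjoint A B : Prop :=
  bounded_operator B /\ forall f g : H, inner (A f) g = inner f (B g).

(* For bounded A there is exactly one such B, by the Riesz representation
   theorem. *)
Definition adjoint A : H -> H := xget (fun=> 0) [set B | is_adjoint A B].

(* In [R[i]], [0 <= z] says that z is real and nonnegative. *)
Definition positive_operator T : Prop :=
  bounded_operator T /\ forall f : H, 0 <= inner (T f) f.

(* A positive T has exactly one positive square root. *)
Definition sqrt_operator T : H -> H :=
  xget (fun=> 0) [set B | positive_operator B /\ B \o B = T].

Definition abs_operator A : H -> H := sqrt_operator (adjoint A \o A).

End Operators.

Section Berezin.
Context {R : realType} {Omega : Type} {H : rkhsType Omega R}.
Implicit Types A T : H -> H.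

(* The Riesz representative of evaluation at x. *)
Definition reproducing_kernel (x : Omega) : H :=
  xget 0 [set k : H | forall f : H, feval f x = inner f k].

Definition normalized_kernel (x : Omega) : H :=
  `|reproducing_kernel x|^-1 *: reproducing_kernel x.

Definition berezin_radius T : R :=
  sup [set modulus (inner (T (normalized_kernel x)) (normalized_kernel x))
      | x in [set: Omega]].

Definition berezin_norm (sigmat : R -> R -> R) (p : R) A : R :=
  sup [set (let k := normalized_kernel xy.1 in
            let l := normalized_kernel xy.2 in
            sigmat (modulus (inner (A k) l) `^ p)
                   (modulus (inner (adjoint A k) l) `^ p)) `^ p^-1
      | xy in [set: Omega * Omega]].

End Berezin.

Section Means.
Context {R : realType}.
Implicit Types sigma : R -> R -> R.

(* A mean is a function on [0, +oo[ x [0, +oo[: the values of sigma at negative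
   arguments are irrelevant. *)

(* Increasing in the weak sense, as required by a sigma_0 b = b. *)
Definition increasing_in_each sigma : Prop :=
  (forall a a' b : R, 0 <= a -> a <= a' -> 0 <= b -> sigma a b <= sigma a' b) /\
  (forall a b b' : R, 0 <= a -> 0 <= b -> b <= b' -> sigma a b <= sigma a b').

Record is_mean sigma : Prop := IsMean {
  mean_ge0 : forall a b : R, 0 <= a -> 0 <= b -> 0 <= sigma a b ;
  mean_between : forall a b : R, 0 <= a -> 0 <= b -> a <= b ->
    a <= sigma a b /\ sigma a b <= b ;
  mean_increasing : increasing_in_each sigma ;
  mean_homogeneous : forall alpha a b : R, 0 < alpha -> 0 <= a -> 0 <= b ->
    sigma (alpha * a) (alpha * b) = alpha * sigma a b ;
  mean_continuous :
    {within [set ab : R * R | 0 <= ab.1 /\ 0 <= ab.2],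
      continuous (fun ab : R * R => sigma ab.1 ab.2)}
}.

Definition is_symmetric_mean sigma : Prop :=
  is_mean sigma /\ forall a b : R, 0 <= a -> 0 <= b -> sigma a b = sigma b a.

Record is_interpolation_path sigma (sigma_ : R -> R -> R -> R) : Prop :=
  IsInterpolationPath {
  path_mean : forall t : R, 0 <= t -> t <= 1 -> is_mean (sigma_ t) ;
  path_0 : forall a b : R, 0 <= a -> 0 <= b -> sigma_ 0 a b = b ;
  path_1 : forall a b : R, 0 <= a -> 0 <= b -> sigma_ 1 a b = a ;
  path_half : forall a b : R, 0 <= a -> 0 <= b -> sigma_ (2^-1) a b = sigma a b ;
  path_interpolation : forall s t a b : R, 0 <= s -> s <= 1 -> 0 <= t -> t <= 1 ->
    0 <= a -> 0 <= b ->
    sigma (sigma_ t a b) (sigma_ s a b) = sigma_ ((t + s) / 2) a b ;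
  path_increasing : forall t : R, 0 <= t -> t <= 1 ->
    increasing_in_each (sigma_ t)
}.

End Means.

(* Main.v *)
Require Import Defs.
From HB Require Import structures.
From mathcomp Require Import all_boot all_order all_algebra.
From mathcomp Require Import complex.
From mathcomp Require Import all_classical all_reals all_analysis.
From mathcomp Require Import ring lra.
Import numFieldNormedType.Exports.
Import Order.TTheory GRing.Theory Num.Theory.

(** For unit vectors k and l the Cauchy-Schwarz inequality gives
    |<A k, l>|^2 <= ||A k||^2 = <A* A k, k>, and likewise
    |<A* k, l>|^2 <= ||A* k||^2 = <A A* k, k>.  Both right-hand sides are at
    most <(|A|^2 + |A*|^2) k, k>, because |A|^2 = A* A, |A*|^2 = A A* and each
    summand is nonnegative; for k a normalized kernel this is at most
    b = ber(|A|^2 + |A*|^2) ([entry_le_berezin_radius]).  So the two arguments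
    of the mean sigma_t in each entry of the sigma_t-Berezin norm are at most
    b^(p/2), and a mean never exceeds a common bound of its arguments
    ([mean_le]).

    The substance is that |A|^2 = A* A ([abs_operator_sqr]).  The adjoint and
    the square root are picked by choice among the operators with the defining
    property, so their existence has to be established.

    The adjoint comes from the Riesz representation theorem ([riesz]).  A
    bounded real functional psi is represented by the minimizer of
    J f = ||f||^2 - 2 psi f: by the parallelogram identity a minimizing
    sequence is Cauchy, and almost minimality at u forces <f, u> to be close to
    psi f for every f.  The complex case follows by applying this to the real
    part.

    For the square root of a positive T ([positive_sqrt_exists]), scale T so
    that S = 1 - T / M is a symmetric contraction.  If Y = (S + Y^2) / 2 then
    (1 - Y)^2 = 1 - S, so sqrt(M) (1 - Y) is a square root of T, and it is
    positive as soon as Y is a symmetric contraction.  Such a Y is the limit of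
    Y_0 = 0, Y_(n+1) = (S + Y_n^2) / 2 ([sqrt_fixpoint]).  The scalar sequence
    y_n obtained with S = 1 majorizes this iteration: ||Y_n|| <= y_n and
    ||Y_m - Y_n|| <= y_m - y_n for n <= m.  As y_n is nondecreasing and bounded
    by 1, Y_n converges in norm.

    Inner products and norms have complex values here; estimates are carried
    out with the real inner product Re <f, g> and the real number ||f||. *)

Set Implicit Arguments.
Unset Strict Implicit.
Unset Printing Implicit Defensive.

Local Open Scope classical_set_scope.
Local Open Scope ring_scope.
Local Open Scope complex_scope.

(** * The underlying real inner product space *)

Lemma quadratic_discriminant (R : realFieldType) (a b c : R) : 0 <= a ->
  (forall s : R, 0 <= a * s ^+ 2 + 2 * b * s + c) -> b ^+ 2 <= a * c.
Proof.
rewrite le_eqVlt => /predU1P[<-|a_gt0] q_ge0; last first.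
  have := q_ge0 (- b / a).
  have -> : a * (- b / a) ^+ 2 + 2 * b * (- b / a) + c = (a * c - b ^+ 2) / a.
    by field; rewrite gt_eqF.
  by rewrite pmulr_lge0 ?invr_gt0// subr_ge0.
have [->|b_neq0] := eqVneq b 0; first by rewrite mul0r expr0n.
have := q_ge0 (- (c + 1) / (2 * b)); rewrite mul0r add0r.
have -> : 2 * b * (- (c + 1) / (2 * b)) + c = -1 by field.
by rewrite ler0N1.
Qed.

Section RealStructure.
Context {R : realType} {H : hilbertType R}.
Implicit Types (f g h : H) (a s : R) (c z : R[i]).

Definition rnorm f : R := complex.Re `|f|.

Definition rinner f g : R := complex.Re (inner f g).

Lemma normE f : `|f| = (rnorm f)%:C.
Proof. by rewrite /rnorm RRe_real// ger0_real. Qed.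

Lemma rnorm_ge0 f : 0 <= rnorm f.
Proof. by rewrite -ler0c -normE. Qed.

Lemma modulusE z : `|z| = (modulus z)%:C.
Proof. by rewrite /modulus RRe_real// ger0_real. Qed.

Lemma modulus_ge0 z : 0 <= modulus z.
Proof. by rewrite -ler0c -modulusE. Qed.

Lemma modulus_sqr z : modulus z ^+ 2 = complex.Re z ^+ 2 + complex.Im z ^+ 2.
Proof. by apply: complexI; rewrite add_Re2_Im2 modulusE rmorphXn. Qed.

Lemma innerC f g : inner f g = (inner g f)^*.
Proof. by rewrite hermC expr0 mul1r. Qed.

Lemma innerDl f g h : inner (f + g) h = inner f h + inner g h.
Proof. exact: linearDl. Qed.

Lemma innerDr f g h : inner h (f + g) = inner h f + inner h g.
Proof. exact: linearDr. Qed.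

Lemma innerNl f h : inner (- f) h = - inner f h.
Proof. exact: linearNl. Qed.

Lemma innerZl c f h : inner (c *: f) h = c * inner f h.
Proof. exact: linearZl_LR. Qed.

Lemma innerZr c f h : inner h (c *: f) = c^* * inner h f.
Proof. exact: linearZr_LR. Qed.

Lemma inner_self f : inner f f = (rnorm f ^+ 2)%:C.
Proof. by rewrite -sqr_norm_inner normE rmorphXn. Qed.

Lemma rinner_self f : rinner f f = rnorm f ^+ 2.
Proof. by rewrite /rinner inner_self. Qed.

Lemma rinnerC f g : rinner f g = rinner g f.
Proof. by rewrite /rinner innerC; case: (inner g f). Qed.

Lemma rinnerDl f g h : rinner (f + g) h = rinner f h + rinner g h.
Proof. by rewrite /rinner innerDl raddfD. Qed.

Lemma rinnerNl f h : rinner (- f) h = - rinner f h.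
Proof. by rewrite /rinner innerNl raddfN. Qed.

Lemma rinnerZl a f h : rinner (a%:C *: f) h = a * rinner f h.
Proof.
by rewrite /rinner innerZl; case: (inner f h) => x y /=; rewrite mul0r subr0.
Qed.

Lemma rinnerDr f g h : rinner h (f + g) = rinner h f + rinner h g.
Proof. by rewrite rinnerC rinnerDl !(rinnerC h). Qed.

Lemma rinnerNr f h : rinner h (- f) = - rinner h f.
Proof. by rewrite rinnerC rinnerNl (rinnerC h). Qed.

Lemma rinnerZr a f h : rinner h (a%:C *: f) = a * rinner h f.
Proof. by rewrite rinnerC rinnerZl (rinnerC h). Qed.

Definition rinnerE :=
  (rinnerDl, rinnerDr, rinnerNl, rinnerNr, rinnerZl, rinnerZr).

(** A complex inner product is determined by its real part, which is how the
    complex statements are recovered from the real ones. *)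
Lemma Im_inner f g : complex.Im (inner f g) = - rinner ('i *: f) g.
Proof. by rewrite /rinner innerZl mulrC ReiNIm opprK. Qed.

Lemma rinner_inj f g : (forall h, rinner h f = rinner h g) -> f = g.
Proof.
move=> fg; apply/eqP; rewrite -subr_eq0 -normr_eq0 normE.
have : rnorm (f - g) ^+ 2 == 0.
  by rewrite -rinner_self rinnerDr rinnerNr fg subrr.
by rewrite sqrf_eq0 => /eqP ->.
Qed.

Lemma rnormZ c f : rnorm (c *: f) = modulus c * rnorm f.
Proof. by apply: complexI; rewrite rmorphM/= -modulusE -!normE normrZ. Qed.

Lemma modulus_real a : modulus a%:C = `|a|.
Proof. by rewrite /modulus normc_def/= expr0n/= addr0 sqrtr_sqr. Qed.

Lemma rnormD f g : rnorm (f + g) <= rnorm f + rnorm g.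
Proof. by rewrite -lecR rmorphD/= -!normE ler_normD. Qed.

Lemma rnormN f : rnorm (- f) = rnorm f.
Proof. by rewrite /rnorm normrN. Qed.

Lemma rnorm0 : rnorm 0 = 0.
Proof. by rewrite /rnorm normr0. Qed.

Lemma rnorm0_eq0 f : rnorm f = 0 -> f = 0.
Proof. by move=> f0; apply/eqP; rewrite -normr_eq0 normE f0. Qed.

Lemma rnormB f g : rnorm (f - g) = rnorm (g - f).
Proof. by rewrite -rnormN opprB. Qed.

Lemma rinner_le f g : rinner f g <= rnorm f * rnorm g.
Proof.
have : rinner f g ^+ 2 <= rnorm f ^+ 2 * rnorm g ^+ 2.
  apply: quadratic_discriminant => [|s]; first exact: sqr_ge0.
  have := sqr_ge0 (rnorm (s%:C *: f + g)).
  rewrite -!rinner_self !rinnerE (rinnerC g f).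
  by congr (_ <= _); ring.
rewrite -exprMn -[leLHS]real_normK ?num_real// ler_pXn2r ?nnegrE//.
  exact/le_trans/ler_norm.
by rewrite mulr_ge0 ?rnorm_ge0.
Qed.

(** Rotating f by the conjugate of <f, g> makes the inner product real, which
    reduces the bound to the one for real parts. *)
Lemma modulus_inner_le f g : modulus (inner f g) <= rnorm f * rnorm g.
Proof.
set z := inner f g.
have : modulus z ^+ 2 <= modulus z * (rnorm f * rnorm g).
  have := rinner_le (z^* *: f) g.
  have -> : rinner (z^* *: f) g = modulus z ^+ 2.
    by rewrite /rinner innerZl -/z mulrC modulus_sqr; case: z => x y /=; ring.
  by rewrite rnormZ /modulus norm_conjC mulrA.
move: (modulus_ge0 z); rewrite le_eqVlt => /predU1P[<-|z_gt0].
  by rewrite mulr_ge0 ?rnorm_ge0.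
by rewrite expr2 ler_pM2l.
Qed.

End RealStructure.

(** * Completeness, boundedness and the Riesz representation theorem *)

Section Complete.
Context {R : realType} {H : hilbertType R}.
Implicit Types (f g h : H).

(** Completeness in a form that only mentions real estimates: the limit inherits
    the rate of the Cauchy sequence, so later limits need no filters. *)
Lemma complete_with_rate (u : nat -> H) (d : nat -> R) :
  (forall m n, (n <= m)%N -> rnorm (u m - u n) <= d n) ->
  (forall e, 0 < e -> exists n, d n < e) ->
  exists l, forall n, rnorm (u n - l) <= d n.
Proof.
move=> u_rate d0.
have small (e : R[i]) : 0 < e -> exists2 r : R, 0 < r & r%:C = e.
  move=> e_gt0; exists (complex.Re e); last by rewrite RRe_real// gtr0_real.
  by move: e_gt0; rewrite ltcE => /andP[].
have : cauchy (u @ \oo).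
  apply: cauchy_exP => e /small[r r_gt0 <-].
  have [n dn] := d0 r r_gt0; exists (u n); exists n => // m /= n_le_m.
  by rewrite -ball_normE/= normE ltcR rnormB (le_lt_trans (u_rate _ _ n_le_m)).
move=> /cauchy_cvg/cvg_ex[l u_l]; exists l => n.
apply/ler_addgt0Pr => e e_gt0.
have e_gt0' : 0 < e%:C :> R[i] by rewrite ltcR.
have [N _ Nl] := (cvgrPdist_lt _ _).1 u_l _ e_gt0'.
have := Nl (maxn N n) (leq_maxl _ _).
rewrite normE ltcR => /ltW lN.
have := u_rate (maxn N n) n (leq_maxr _ _).
have := rnormD (u n - u (maxn N n)) (u (maxn N n) - l).
rewrite addrA subrK (rnormB (u n) (u _)) (rnormB (u _) l); lra.
Qed.

Lemma bounded_operatorP (A : H -> H) : bounded_operator A <->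
  linear A /\ exists2 M : R, 0 <= M & forall f, rnorm (A f) <= M * rnorm f.
Proof.
split=> -[linA bndA]; split=> //.
  pose L : {linear H -> H} := HB.pack A (GRing.isLinear.Build _ _ _ _ A linA).
  have /linear_boundedP/pinfty_ex_gt0[M M_gt0 AM] :
      bounded_near L (nbhs (0 : H)) by exact: bndA.
  have ME : (complex.Re M)%:C = M by rewrite RRe_real// gtr0_real.
  exists (complex.Re M); first by rewrite -ler0c ME ltW.
  by move=> f; rewrite -lecR rmorphM/= ME -!normE; exact: AM.
have [M M_ge0 AM] := bndA.
apply/ex_bound; exists M%:C; apply/nbhs_norm0P; exists 1 => //= f /=.
rewrite !normE lecR -[1]/(1%:C) ltcR => f1.
by apply: le_trans (AM f) _; rewrite ler_piMr// ltW.
Qed.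

(** The representing vector is the limit of a minimizing sequence u of
    J f = ||f||^2 - 2 psi f.  Minimality is only used approximately: J being
    within e^2 of its infimum at u n makes s |-> J (u n + s f) - J (u n) + e^2 a
    nonnegative quadratic polynomial, whose discriminant bounds
    <f, u n> - psi f. *)
Lemma riesz_real (psi : H -> R) (M : R) :
  (forall f g, psi (f + g) = psi f + psi g) ->
  (forall (a : R) f, psi (a%:C *: f) = a * psi f) ->
  (forall f, psi f <= M * rnorm f) ->
  exists k, forall f, psi f = rinner f k.
Proof.
move=> psiD psiZ psi_le.
pose J f := rnorm f ^+ 2 - 2 * psi f.
(* J f >= (||f|| - M)^2 - M^2 *)
have J_lb : lbound (range J) (- M ^+ 2).
  move=> _ [f _ <-]; rewrite /J.
  by have := psi_le f; have := sqr_ge0 (rnorm f - M); nra.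
have J_inf : has_inf (range J) by split; [exists (J 0), 0|exists (- M ^+ 2)].
have inf_le f : inf (range J) <= J f.
  by apply: ge_inf; [exists (- M ^+ 2)|exists f].
pose e n : R := n.+1%:R^-1.
have e_gt0 n : 0 < e n by rewrite invr_gt0.
have e_le m n : (n <= m)%N -> e m <= e n.
  by move=> nm; rewrite lef_pV2 ?posrE// ler_nat.
have e_small x : 0 < x -> exists n, 4 * e n < x.
  move=> x_gt0; exists (Num.truncn (4 / x)).
  by rewrite /e ltr_pdivrMr// mulrC -ltr_pdivrMr// truncnS_gt.
have /choice[u u_min] n : exists f, J f < inf (range J) + e n ^+ 2.
  have [_ [f _ <-] Jf] := inf_adherent (exprn_gt0 2 (e_gt0 n)) J_inf.
  by exists f.
have parallelogram f g :
    rnorm (f - g) ^+ 2 = 2 * J f + 2 * J g - 4 * J (2^-1%:C *: (f + g)).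
  rewrite /J -!rinner_self psiZ psiD !rinnerE.
  by rewrite (rinnerC g f); field.
have u_rate m n : (n <= m)%N -> rnorm (u m - u n) <= 2 * e n.
  move=> nm; rewrite -(@ler_pXn2r _ 2)// ?nnegrE ?rnorm_ge0// ?mulr_ge0 ?ltW//.
  rewrite parallelogram.
  have := u_min m; have := u_min n; have := inf_le (2^-1%:C *: (u m + u n)).
  by have := e_le m n nm; have := e_gt0 m; nra.
have almost f n : `|rinner f (u n) - psi f| <= e n * rnorm f.
  rewrite -(@ler_pXn2r _ 2)// ?nnegrE ?mulr_ge0 ?rnorm_ge0 ?(ltW (e_gt0 n))//.
  rewrite real_normK ?num_real// exprMn mulrC.
  apply: quadratic_discriminant => [|s]; first exact: sqr_ge0.
  have := inf_le (u n + s%:C *: f); have := u_min n.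
  rewrite /J psiD psiZ -!rinner_self !rinnerE.
  by rewrite (rinnerC (u n) f) !rinner_self; lra.
have [k u_k] : exists k, forall n, rnorm (u n - k) <= 2 * e n.
  apply: complete_with_rate => // x /e_small[n en]; exists n.
  by have := e_gt0 n; lra.
exists k => f.
apply/eqP; rewrite -subr_eq0 -normr_le0.
apply/ler_addgt0Pr => x x_gt0; rewrite add0r.
have f_gt0 : 0 < rnorm f + 1 by have := rnorm_ge0 f; lra.
have [n] := e_small (x / (rnorm f + 1)) (divr_gt0 x_gt0 f_gt0).
rewrite ltr_pdivlMr// => en.
have := almost f n.
have := rinner_le f (u n - k); have := rinner_le f (k - u n).
rewrite !(rinnerDr, rinnerNr) (rnormB k).
have := u_k n; have := rnorm_ge0 f; have := e_gt0 n.
set a := rinner f (u n); set b := rinner f k.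
rewrite ler_norml => ? ? ? ? ? /andP[? ?].
rewrite ler_norml; apply/andP; split; nra.
Qed.

End Complete.

(** * The adjoint *)

Section Adjoint.
Context {R : realType} {H : hilbertType R}.
Implicit Types (f g h : H) (A B T : H -> H).

(** The imaginary part of phi is recovered from the real part at i f. *)
Lemma riesz (phi : H -> R[i]) (M : R) :
  (forall c f g, phi (c *: f + g) = c * phi f + phi g) ->
  (forall f, modulus (phi f) <= M * rnorm f) ->
  exists k, forall f, phi f = inner f k.
Proof.
move=> phi_lin phi_le.
have phi0 : phi 0 = 0.
  have := phi_lin 1 0 0; rewrite scale1r addr0 mul1r => /eqP.
  by rewrite -subr_eq0 opprD addrA subrr sub0r oppr_eq0 => /eqP.
have phiZ c f : phi (c *: f) = c * phi f.
  by rewrite -[c *: f]addr0 phi_lin phi0 addr0.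
have [f g|a f|f|k phi_k] := @riesz_real R H (fun f => complex.Re (phi f)) M.
- by rewrite -[f in f + _]scale1r phi_lin mul1r raddfD.
- by rewrite phiZ; case: (phi f) => x y /=; rewrite mul0r subr0.
- apply: le_trans (phi_le f); rewrite -lecR -modulusE.
  by apply: le_trans (normc_ge_Re _); rewrite lecR ler_norm.
exists k => f; apply/eqP; rewrite eq_complex; apply/andP; split; apply/eqP.
  exact: phi_k.
by rewrite Im_inner -phi_k phiZ mulrC ReiNIm opprK.
Qed.

Lemma inner_inj f g : (forall h, inner h f = inner h g) -> f = g.
Proof. by move=> fg; apply: rinner_inj => h; rewrite /rinner fg. Qed.

(** B g represents the functional f |-> <A f, g>. *)
Lemma adjoint_exists A : bounded_operator A -> exists B, is_adjoint A B.
Proof.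
move=> /bounded_operatorP[linA [M M_ge0 AM]].
have /choice[B AB] g : exists k, forall f, inner (A f) g = inner f k.
  apply: (@riesz (fun f => inner (A f) g) (M * rnorm g)) => [c f f'|f].
    by rewrite linA innerDl innerZl.
  rewrite mulrAC (le_trans (modulus_inner_le _ _))// ler_wpM2r//.
  exact: rnorm_ge0.
exists B; split=> [|f g]; last exact: AB.
apply/bounded_operatorP; split.
  move=> c f g; apply: inner_inj => h.
  by rewrite -AB !(innerDr, innerZr) !AB.
exists M => // f.
have := rinner_le (A (B f)) f; have := AM (B f).
rewrite /rinner AB inner_self/=.
have [->|Bf_neq0] := eqVneq (rnorm (B f)) 0.
  by rewrite mulr_ge0 ?rnorm_ge0.
have Bf_gt0 : 0 < rnorm (B f) by rewrite lt_neqAle eq_sym Bf_neq0 rnorm_ge0.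
move=> le1 le2; rewrite -(ler_pM2l Bf_gt0) -expr2.
by apply: le_trans le2 _; rewrite mulrCA mulrA ler_wpM2r// rnorm_ge0.
Qed.

Lemma adjointP A : bounded_operator A -> is_adjoint A (adjoint A).
Proof.
by move=> /adjoint_exists; exact: (@xgetPex _ _ [set B | is_adjoint A B]).
Qed.

End Adjoint.

(** * The square root of a positive operator *)

Section SquareRoot.
Context {R : realType} {H : hilbertType R}.
Implicit Types (f g h : H) (A B T S : H -> H).

Lemma linear_sub A : linear A -> {morph A : f g / f - g}.
Proof.
by move=> linA f g; rewrite addrC -[- g]scaleN1r linA scaleN1r addrC.
Qed.

Lemma linear_scale A : linear A -> forall c, {morph A : f / c *: f}.
Proof.
move=> linA c f; rewrite -[c *: f]addr0 -(subrr 0) addrA linear_sub//.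
by rewrite [A (_ + 0)]linA addrK.
Qed.

Definition symmetric_operator A := forall f g, rinner (A f) g = rinner f (A g).

(** Picard iteration for Y = (S + Y^2) / 2, where Y^2 is Y composed with Y. *)
Fixpoint sqrt_iter S n : H -> H :=
  if n is m.+1 then fun f => 2^-1%:C *: (S f + sqrt_iter S m (sqrt_iter S m f))
  else fun=> 0.

(** The same iteration for the scalar S = 1, whose limit is 1. *)
Fixpoint sqrt_rate n : R :=
  if n is m.+1 then 2^-1 * (1 + sqrt_rate m ^+ 2) else 0.

Lemma sqrt_rate_itv n : 0 <= sqrt_rate n <= 1.
Proof.
by elim: n => /= [|n /andP[? ?]]; [rewrite lexx ler01|apply/andP; split; nra].
Qed.

Lemma sqrt_rate_nondecreasing : {homo sqrt_rate : m n / (m <= n)%N >-> m <= n}.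
Proof.
by apply/nondecreasing_seqP => n /=; have := sqr_ge0 (sqrt_rate n - 1); lra.
Qed.

Let two_inv : modulus 2^-1%:C = 2^-1 :> R.
Proof. by rewrite modulus_real ger0_norm. Qed.

Lemma sqrt_iter_linear S n : linear S -> linear (sqrt_iter S n).
Proof.
move=> linS; elim: n => /= [|n IHn] c f g; first by rewrite scaler0 addr0.
by rewrite linS !IHn addrACA -scalerDr [LHS]scalerDr !scalerA [c * _]mulrC.
Qed.

Lemma sqrt_iter_symmetric S n :
  symmetric_operator S -> symmetric_operator (sqrt_iter S n).
Proof.
move=> symS; elim: n => /= [|n IHn] f g.
  by rewrite -(scale0r 0) rinnerZl rinnerZr !mul0r.
by rewrite rinnerZl rinnerZr rinnerDl rinnerDr symS !IHn.
Qed.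

Lemma sqrt_iter_le S n f : (forall f, rnorm (S f) <= rnorm f) ->
  rnorm (sqrt_iter S n f) <= sqrt_rate n * rnorm f.
Proof.
move=> contrS; elim: n f => /= [|n IHn] f; first by rewrite rnorm0 mul0r.
have /andP[? ?] := sqrt_rate_itv n.
rewrite rnormZ two_inv -mulrA ler_pM2l// mulrDl mul1r.
apply: le_trans (rnormD _ _) _; apply: lerD => //.
by apply: le_trans (IHn _) _; rewrite expr2 -mulrA ler_wpM2l.
Qed.

(** A^2 - B^2 = A (A - B) + (A - B) B holds without commutation, so the
    difference of squares is bounded as for scalars. *)
Lemma sqr_sub_le A B (a c : R) f :
  linear A -> 0 <= a ->
  (forall f, rnorm (A f) <= a * rnorm f) ->
  rnorm (A f - B f) <= c * rnorm f ->
  rnorm (A (B f) - B (B f)) <= c * rnorm (B f) ->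
  rnorm (A (A f) - B (B f)) <= c * (a * rnorm f + rnorm (B f)).
Proof.
move=> linA a_ge0 Aa ABf ABBf.
have -> : A (A f) - B (B f) = A (A f - B f) + (A (B f) - B (B f)).
  by rewrite (linear_sub linA) subrKA.
apply: le_trans (rnormD _ _) _; rewrite mulrDr; apply: lerD => //.
by apply: le_trans (Aa _) _; rewrite mulrCA ler_wpM2l.
Qed.

(** The scalar increments satisfy
    y_(n+2) - y_(n+1) = (y_(n+1) - y_n) (y_(n+1) + y_n) / 2, and [sqr_sub_le]
    gives the operator increments the corresponding bound. *)
Lemma sqrt_iter_step S n f : linear S -> (forall f, rnorm (S f) <= rnorm f) ->
  rnorm (sqrt_iter S n.+1 f - sqrt_iter S n f) <=
  (sqrt_rate n.+1 - sqrt_rate n) * rnorm f.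
Proof.
move=> linS contrS; elim: n f => [|n IHn] f.
  by rewrite !subr0; exact: sqrt_iter_le.
have -> : sqrt_rate n.+2 - sqrt_rate n.+1 =
    2^-1 * ((sqrt_rate n.+1 - sqrt_rate n) * (sqrt_rate n.+1 + sqrt_rate n)).
  by rewrite /=; ring.
have iterE m : sqrt_iter S m.+1 f =
    2^-1%:C *: (S f + sqrt_iter S m (sqrt_iter S m f)) by [].
rewrite (iterE n.+1) {2}(iterE n).
rewrite -scalerBr opprD addrACA subrr add0r rnormZ two_inv -mulrA ler_pM2l//.
have [a_ge0 _] := andP (sqrt_rate_itv n.+1).
have := sqr_sub_le (sqrt_iter_linear n.+1 linS) a_ge0
  (fun f => sqrt_iter_le n.+1 f contrS) (IHn f) (IHn _).
move=> /le_trans; apply; rewrite -mulrA ler_wpM2l//.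
  by rewrite subr_ge0 sqrt_rate_nondecreasing.
by rewrite mulrDl lerD2l sqrt_iter_le.
Qed.

Lemma sqrt_iter_rate S m n f : linear S -> (forall f, rnorm (S f) <= rnorm f) ->
  (n <= m)%N ->
  rnorm (sqrt_iter S m f - sqrt_iter S n f) <=
  (sqrt_rate m - sqrt_rate n) * rnorm f.
Proof.
move=> linS contrS; elim: m => [|m IHm].
  by rewrite leqn0 => /eqP ->; rewrite !subrr rnorm0 mul0r.
rewrite leq_eqVlt => /predU1P[->|]; first by rewrite !subrr rnorm0 mul0r.
rewrite ltnS => /IHm nm; have := sqrt_iter_step m f linS contrS.
have := rnormD (sqrt_iter S m.+1 f - sqrt_iter S m f)
  (sqrt_iter S m f - sqrt_iter S n f).
rewrite addrA subrK; lra.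
Qed.

(** The limit of [sqrt_iter]: its properties pass to the limit at the rate
    L - sqrt_rate n, with L the supremum of the scalar iteration. *)
Lemma sqrt_fixpoint S : linear S -> symmetric_operator S ->
    (forall f, rnorm (S f) <= rnorm f) ->
  exists Y, [/\ linear Y, symmetric_operator Y,
    (forall f, rnorm (Y f) <= rnorm f) &
    forall f, Y f = 2^-1%:C *: (S f + Y (Y f))].
Proof.
move=> linS symS contrS.
pose L : R := sup (range sqrt_rate).
have r_sup : has_sup (range sqrt_rate).
  split; first by exists (sqrt_rate 0), 0%N.
  by exists 1 => _ [n _ <-]; have /andP[] := sqrt_rate_itv n.
have r_le n : sqrt_rate n <= L by apply: ub_le_sup; [exact: r_sup.2|exists n].
have small C e : 0 <= C -> 0 < e -> exists n, (L - sqrt_rate n) * C < e.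
  move=> C_ge0 e_gt0; have C1_gt0 : 0 < C + 1 by rewrite ltr_wpDl.
  have [_ [n _ <-] Ln] := sup_adherent (divr_gt0 e_gt0 C1_gt0) r_sup.
  exists n; have : L - sqrt_rate n < e / (C + 1) by move: Ln; rewrite -/L; lra.
  rewrite ltr_pdivlMr//; have := r_le n; nra.
have eq_lim (x y : H) C : 0 <= C ->
    (forall n, rnorm (x - y) <= (L - sqrt_rate n) * C) -> x = y.
  move=> C_ge0 xy; apply/eqP; rewrite -subr_eq0; apply/eqP/rnorm0_eq0/eqP.
  rewrite eq_le rnorm_ge0 andbT; apply/ler_addgt0Pr => e e_gt0; rewrite add0r.
  by have [n /ltW] := small C e C_ge0 e_gt0; exact: le_trans.
have /choice[Y Y_lim] f : exists l, forall n,
    rnorm (sqrt_iter S n f - l) <= (L - sqrt_rate n) * rnorm f.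
  apply: complete_with_rate => [m n nm|e e_gt0].
    apply: le_trans (sqrt_iter_rate f linS contrS nm) _.
    by rewrite ler_wpM2r ?rnorm_ge0// lerB.
  by apply: small => //; exact: rnorm_ge0.
have Y_contr f : rnorm (Y f) <= rnorm f.
  apply/ler_addgt0Pr => e e_gt0.
  have [n ne] := small (rnorm f) e (rnorm_ge0 f) e_gt0.
  have := rnormD (Y f - sqrt_iter S n f) (sqrt_iter S n f).
  rewrite subrK rnormB.
  have := Y_lim f n; have := sqrt_iter_le n f contrS.
  have /andP[_] := sqrt_rate_itv n; have := rnorm_ge0 f; nra.
exists Y; split=> //.
- move=> c f g.
  apply: (eq_lim _ _ (rnorm (c *: f + g) + (modulus c * rnorm f + rnorm g))).
    by rewrite !addr_ge0 ?mulr_ge0 ?rnorm_ge0 ?modulus_ge0.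
  move=> n.
  have -> : Y (c *: f + g) - (c *: Y f + Y g) =
      (Y (c *: f + g) - sqrt_iter S n (c *: f + g)) +
      (c *: (sqrt_iter S n f - Y f) + (sqrt_iter S n g - Y g)).
    rewrite (sqrt_iter_linear n linS) scalerBr [X in _ = _ + X]addrACA -opprD.
    by rewrite subrKA.
  rewrite mulrDr; apply: le_trans (rnormD _ _) _; apply: lerD.
    by rewrite rnormB; exact: Y_lim.
  rewrite mulrDr; apply: le_trans (rnormD _ _) _.
  apply: lerD; last exact: Y_lim.
  by rewrite rnormZ mulrCA ler_wpM2l ?modulus_ge0.
- move=> f g; apply/eqP; rewrite -subr_eq0 -normr_le0.
  apply/ler_addgt0Pr => e e_gt0.
  have C_ge0 : 0 <= 2 * (rnorm f * rnorm g) by rewrite !mulr_ge0 ?rnorm_ge0.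
  have [n ne] := small _ _ C_ge0 e_gt0; rewrite add0r.
  have -> : rinner (Y f) g - rinner f (Y g) =
      rinner (Y f - sqrt_iter S n f) g + rinner f (sqrt_iter S n g - Y g).
    by rewrite !rinnerE (sqrt_iter_symmetric n symS) subrKA.
  apply: le_trans (ler_normD _ _) _; apply: le_trans (ltW ne).
  have norm_le (x y : H) : `|rinner x y| <= rnorm x * rnorm y.
    rewrite ler_norml rinner_le andbT lerNl -rinnerNl.
    by apply: le_trans (rinner_le _ _) _; rewrite rnormN.
  have := norm_le (Y f - sqrt_iter S n f) g.
  have := norm_le f (sqrt_iter S n g - Y g).
  rewrite (rnormB (Y f)).
  have := Y_lim f n; have := Y_lim g n.
  by have := rnorm_ge0 f; have := rnorm_ge0 g; nra.
- move=> f; apply: (eq_lim _ _ (rnorm f + (rnorm f + rnorm (Y f)))).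
    by rewrite !addr_ge0 ?rnorm_ge0.
  move=> n.
  have -> : Y f - 2^-1%:C *: (S f + Y (Y f)) =
      (Y f - sqrt_iter S n.+1 f) +
      2^-1%:C *: (sqrt_iter S n (sqrt_iter S n f) - Y (Y f)).
    rewrite -{1}[Y f](subrK (sqrt_iter S n.+1 f)) -addrA; congr (_ + _).
    rewrite -[sqrt_iter S n.+1 f]/(2^-1%:C *: _) -scalerBr.
    by rewrite opprD addrACA subrr add0r.
  rewrite mulrDr; apply: le_trans (rnormD _ _) _; apply: lerD.
    rewrite rnormB; apply: le_trans (Y_lim _ _) _.
    by rewrite ler_wpM2r ?rnorm_ge0// lerB// sqrt_rate_nondecreasing.
  have n_le f := sqrt_iter_le n f contrS.
  have /andP[a_ge0 a_le1] := sqrt_rate_itv n.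
  have := sqr_sub_le (sqrt_iter_linear n linS) a_ge0 n_le
    (Y_lim f n) (Y_lim _ n).
  rewrite rnormZ two_inv.
  have : 0 <= L - sqrt_rate n by rewrite subr_ge0.
  set x := rnorm (_ - Y (Y f)); move=> d_ge0 le_x.
  have : (L - sqrt_rate n) * (sqrt_rate n * rnorm f) <=
      (L - sqrt_rate n) * rnorm f.
    by rewrite ler_wpM2l// ler_piMl ?rnorm_ge0.
  have : 0 <= (L - sqrt_rate n) * rnorm f by rewrite mulr_ge0 ?rnorm_ge0.
  have : 0 <= (L - sqrt_rate n) * rnorm (Y f) by rewrite mulr_ge0 ?rnorm_ge0.
  move: le_x; rewrite !mulrDr; lra.
Qed.

(** Polarization: <T h, h> is real for h = i f + g as well as for f and g. *)
Lemma positive_symmetric T : positive_operator T -> symmetric_operator T.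
Proof.
move=> [[linT _] T_ge0] f g.
have Im0 h : complex.Im (inner (T h) h) = 0 by exact/ger0_Im/T_ge0.
have := Im0 ('i *: f + g).
rewrite linT !(innerDl, innerDr) !raddfD/= !Im0 addr0.
have inner_i h k : inner ('i *: h) ('i *: k) = inner h k.
  rewrite innerZl innerZr mulrA; case: (inner _ _) => u v /=.
  by apply/eqP; rewrite eq_complex/=; apply/andP; split; apply/eqP; ring.
rewrite inner_i Im0 add0r !Im_inner scalerA -expr2 sqr_i scaleN1r.
rewrite rinnerNl opprK.
by rewrite [rinner ('i *: _) _]/rinner inner_i -/(rinner _ _) (rinnerC f); lra.
Qed.

Lemma symmetric_inner_ge0 B f : linear B -> symmetric_operator B ->
  0 <= rinner (B f) f -> 0 <= inner (B f) f.
Proof.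
move=> linB symB Bf_ge0; rewrite lecE Bf_ge0 andbT/=; apply/eqP.
have : complex.Im (inner (B f) f) = - complex.Im (inner f (B f)).
  by rewrite innerC; case: (inner f _).
rewrite !Im_inner opprK -[in RHS]symB (linear_scale linB); lra.
Qed.

(** With M a bound of T, positivity at f - T f / M gives
    ||T f||^2 <= M <T f, f>, which makes S = 1 - T / M a contraction.  For the
    fixed point Y of [sqrt_fixpoint], M (1 - Y)^2 = M (1 - S) = T. *)
Lemma positive_sqrt_exists T : positive_operator T ->
  exists B, positive_operator B /\ B \o B = T.
Proof.
move=> posT; have symT := positive_symmetric posT.
move: posT => [/bounded_operatorP[linT [M0 M0_ge0 TM0]] T_ge0].
have rT_ge0 f : 0 <= rinner (T f) f by have := T_ge0 f; rewrite lecE => /andP[].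
pose M := M0 + 1; have M_gt0 : 0 < M by rewrite /M; lra.
have TM f : rnorm (T f) <= M * rnorm f.
  by apply: le_trans (TM0 f) _; rewrite ler_wpM2r ?rnorm_ge0// /M; lra.
have T_sqr f : M^-1 * rnorm (T f) ^+ 2 <= rinner (T f) f.
  have := rT_ge0 (f - M^-1%:C *: T f).
  rewrite linear_sub// linear_scale// !rinnerE.
  rewrite (symT (T f) f) rinner_self.
  have : rinner (T (T f)) (T f) <= M * rnorm (T f) ^+ 2.
    apply: le_trans (rinner_le _ _) _.
    by rewrite expr2 mulrA ler_wpM2r ?rnorm_ge0.
  move=> x_le.
  have : M^-1 * (M^-1 * rinner (T (T f)) (T f)) <= M^-1 * rnorm (T f) ^+ 2.
    by rewrite ler_pM2l ?invr_gt0// ler_pdivrMl.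
  lra.
pose S f := f - M^-1%:C *: T f.
have linS : linear S.
  move=> c f g; rewrite /S linT scalerDr opprD addrACA scalerBr !scalerA.
  by rewrite [c * _]mulrC.
have symS : symmetric_operator S.
  move=> f g; rewrite /S !rinnerE.
  by rewrite symT.
have contrS f : rnorm (S f) <= rnorm f.
  rewrite -(@ler_pXn2r _ 2)// ?nnegrE ?rnorm_ge0// -!rinner_self /S.
  rewrite !rinnerE.
  rewrite (rinnerC f (T f)) [rinner (T f) (T f)]rinner_self.
  have := ler_wpM2l (ltW (divr_gt0 ltr01 M_gt0)) (T_sqr f).
  have : 0 <= M^-1 * rinner (T f) f by rewrite mulr_ge0 ?invr_ge0 ?(ltW M_gt0).
  rewrite !mul1r; lra.
have [Y [linY symY contrY YE]] := sqrt_fixpoint linS symS contrS.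
pose B f := (Num.sqrt M)%:C *: (f - Y f).
have symB : symmetric_operator B.
  move=> f g; rewrite /B !rinnerE.
  by rewrite symY.
have linB : linear B.
  move=> c f g; rewrite /B linY opprD addrACA -scalerBr scalerDr !scalerA.
  by rewrite mulrC.
exists B; split; last first.
  apply/funext => f; rewrite /B /= (linear_scale linY) (linear_sub linY).
  rewrite -scalerBr scalerA -rmorphM -expr2 sqr_sqrtr ?(ltW M_gt0)//.
  have Y2 : S f + Y (Y f) = Y f + Y f.
    apply: (@scalerI _ _ 2^-1%:C); rewrite ?fmorph_eq0 ?invr_eq0 ?pnatr_eq0//.
    by rewrite -YE scalerDr -scalerDl -rmorphD/= -[2^-1]mul1r -splitr scale1r.
  rewrite opprB addrACA -opprD -Y2 opprD addrACA subrr addr0.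
  by rewrite /S subKr scalerA -rmorphM/= divff ?scale1r// gt_eqF.
split=> [|f].
  apply/bounded_operatorP; split=> //.
  exists (Num.sqrt M * 2) => [|f]; first by rewrite mulr_ge0 ?sqrtr_ge0.
  rewrite rnormZ modulus_real ger0_norm ?sqrtr_ge0// -mulrA.
  rewrite ler_wpM2l ?sqrtr_ge0//.
  by have := rnormD f (- Y f); have := contrY f; rewrite rnormN; lra.
apply: symmetric_inner_ge0 => //; rewrite /B rinnerZl mulr_ge0 ?sqrtr_ge0//.
rewrite rinnerDl rinnerNl rinner_self.
have := rinner_le (Y f) f; have := contrY f; have := rnorm_ge0 f; nra.
Qed.

Lemma sqrt_operatorP T : positive_operator T ->
  sqrt_operator T \o sqrt_operator T = T.
Proof.
move=> /positive_sqrt_exists.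
by move=> /(@xgetPex _ (fun=> 0) [set B | positive_operator B /\ B \o B = T])[].
Qed.

End SquareRoot.

(** * The modulus of an operator *)

Section Modulus.
Context {R : realType} {H : hilbertType R}.
Implicit Types (f : H) (A B : H -> H).

Lemma inner_adjoint A f : bounded_operator A ->
  inner (adjoint A (A f)) f = (rnorm (A f) ^+ 2)%:C.
Proof.
by move=> /adjointP[_ adjA]; rewrite innerC -adjA -innerC inner_self.
Qed.

Lemma bounded_add A B :
  bounded_operator A -> bounded_operator B -> bounded_operator (A \+ B).
Proof.
move=> /bounded_operatorP[linA [M M_ge0 AM]].
move=> /bounded_operatorP[linB [N N_ge0 BN]].
apply/bounded_operatorP; split.
  by move=> c f g; rewrite /= linA linB addrACA -scalerDr.
exists (M + N) => [|f /=]; first exact: addr_ge0.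
by rewrite mulrDl; apply: le_trans (rnormD _ _) (lerD _ _).
Qed.

Lemma bounded_comp A B :
  bounded_operator A -> bounded_operator B -> bounded_operator (A \o B).
Proof.
move=> /bounded_operatorP[linA [M M_ge0 AM]].
move=> /bounded_operatorP[linB [N N_ge0 BN]].
apply/bounded_operatorP; split; first by move=> c f g; rewrite /= linB linA.
exists (M * N) => [|f /=]; first exact: mulr_ge0.
by apply: le_trans (AM _) _; rewrite -mulrA ler_wpM2l.
Qed.

Lemma adjoint_comp_positive A :
  bounded_operator A -> positive_operator (adjoint A \o A).
Proof.
move=> bndA; have [bndA' _] := adjointP bndA; split; first exact: bounded_comp.
by move=> f; rewrite /= inner_adjoint// ler0c sqr_ge0.
Qed.

Lemma abs_operator_sqr A : bounded_operator A ->
  abs_operator A \o abs_operator A = adjoint A \o A.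
Proof. by move=> bndA; exact/sqrt_operatorP/adjoint_comp_positive. Qed.

End Modulus.

(** * Berezin norms *)

(** By monotonicity sigma a b <= sigma c c, and the value at (c, c) lies between
    c and c. *)
Lemma mean_le (R : realType) (sigma : R -> R -> R) (a b c : R) :
  is_mean sigma -> 0 <= a -> 0 <= b -> a <= c -> b <= c -> sigma a b <= c.
Proof.
move=> sigma_mean a_ge0 b_ge0 ac bc; have c_ge0 := le_trans a_ge0 ac.
have [incl incr] := mean_increasing sigma_mean.
have [_] := mean_between sigma_mean c_ge0 c_ge0 (lexx c); apply: le_trans.
by apply: le_trans (incl _ _ _ a_ge0 ac b_ge0) _; apply: incr.
Qed.

Section Berezin.
Context {R : realType} {Omega : Type} {H : rkhsType Omega R}.
Implicit Types (A T : H -> H) (x y : Omega).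

Lemma rnorm_normalized_kernel_le x : rnorm (normalized_kernel x : H) <= 1.
Proof.
rewrite /normalized_kernel; set k := reproducing_kernel x.
rewrite rnormZ -lecR rmorphM/= -modulusE -normE normfV normr_id.
have [->|k0] := eqVneq k 0; first by rewrite normr0 mulr0 ler01.
by rewrite mulVf// normr_eq0.
Qed.

Lemma berezin_radius_ge T x : bounded_operator T ->
  modulus (inner (T (normalized_kernel x)) (normalized_kernel x)) <=
  berezin_radius T.
Proof.
move=> /bounded_operatorP[_ [M M_ge0 TM]]; apply: ub_le_sup; last by exists x.
exists M => _ [y _ <-]; apply: le_trans (modulus_inner_le _ _) _.
have := rnorm_normalized_kernel_le y; have := TM (normalized_kernel y).
set k := normalized_kernel y; have := rnorm_ge0 k; have := rnorm_ge0 (T k); nra.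
Qed.

(** Cauchy-Schwarz bounds the two entries by ||A k||^2 and ||A* k||^2, whose sum
    is <T k, k>, a value of the Berezin transform of T. *)
Lemma entry_le_berezin_radius A x y : bounded_operator A ->
  let T := (adjoint A \o A) \+ (adjoint (adjoint A) \o adjoint A) in
  modulus (inner (A (normalized_kernel x)) (normalized_kernel y)) ^+ 2 <=
    berezin_radius T /\
  modulus (inner (adjoint A (normalized_kernel x)) (normalized_kernel y)) ^+ 2
    <= berezin_radius T.
Proof.
move=> bndA T; have [bndA' _] := adjointP bndA.
have [bndA'' _] := adjointP bndA'.
have bndT : bounded_operator T.
  by apply: bounded_add; exact: bounded_comp.
set k := normalized_kernel x; set l := normalized_kernel y.
have := berezin_radius_ge x bndT; rewrite -/k /T/= innerDl !inner_adjoint//.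
rewrite -rmorphD modulus_real ger0_norm ?addr_ge0 ?sqr_ge0// => le_ber.
have sqr_le f : modulus (inner f l) ^+ 2 <= rnorm f ^+ 2.
  have := modulus_inner_le f l; have := rnorm_normalized_kernel_le y.
  rewrite -/l; have := rnorm_ge0 f; have := modulus_ge0 (inner f l).
  by move=> *; rewrite ler_pXn2r ?nnegrE//; nra.
split; apply: le_trans (sqr_le _) (le_trans _ le_ber).
  by rewrite lerDl sqr_ge0.
by rewrite lerDr sqr_ge0.
Qed.

End Berezin.

Theorem theorem3p14 (R : realType) (Omega : Type) (H : rkhsType Omega R)
    (Omega_nonempty : inhabited Omega)
    (kernel_neq0 : forall x : Omega, reproducing_kernel x != 0 :> H)
    (sigma : R -> R -> R) (sigma_ : R -> R -> R -> R)
    (sigma_mean : is_symmetric_mean sigma)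
    (sigma_path : is_interpolation_path sigma sigma_)
    (t : R) (t_ge0 : 0 <= t) (t_le1 : t <= 1)
    (A : H -> H) (A_bounded : bounded_operator A)
    (p : R) (p_ge1 : 1 <= p) :
  berezin_norm (sigma_ t) p A `^ p <=
  berezin_radius
    ((abs_operator A \o abs_operator A) \+
     (abs_operator (adjoint A) \o abs_operator (adjoint A)) : H -> H) `^ (p / 2).
Proof.
have [A'_bounded _] := adjointP A_bounded.
rewrite !abs_operator_sqr//; set b := berezin_radius _.
have entry x y := entry_le_berezin_radius x y A_bounded.
have [x0] := Omega_nonempty.
have b_ge0 : 0 <= b by apply: le_trans (entry x0 x0).1; exact: sqr_ge0.
have p_gt0 : 0 < p by lra.
have entry_powR_le z : 0 <= z -> z ^+ 2 <= b -> z `^ p <= b `^ (p / 2).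
  move=> z_ge0 zb.
  have -> : z `^ p = (z ^+ 2) `^ (p / 2).
    by rewrite -powR_mulrn// -powRrM; congr (_ `^ _); field.
  by apply: ge0_ler_powR; rewrite ?nnegrE ?sqr_ge0//; lra.
pose entries := [set
  (let k := normalized_kernel xy.1 in let l := normalized_kernel xy.2 in
   sigma_ t (modulus (inner (A k) l) `^ p)
            (modulus (inner (adjoint A k) l) `^ p)) `^ p^-1
  | xy in [set: Omega * Omega]].
have sigmat_mean := path_mean sigma_path t_ge0 t_le1.
have norm_ub : ubound entries (b `^ 2^-1).
  move=> _ [[x y] _ <-] /=.
  have -> : b `^ 2^-1 = (b `^ (p / 2)) `^ p^-1.
    by rewrite -powRrM; congr (_ `^ _); field; rewrite gt_eqF.
  apply: ge0_ler_powR; rewrite ?nnegrE ?invr_ge0 ?powR_ge0//; first lra.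
    by apply: (mean_ge0 sigmat_mean); exact: powR_ge0.
  apply: mean_le => //; try exact: powR_ge0.
    by apply: entry_powR_le; [exact: modulus_ge0|exact: (entry x y).1].
  by apply: entry_powR_le; [exact: modulus_ge0|exact: (entry x y).2].
(* Nonnegativity of the norm is needed to raise the bound to the power p; it
   comes from any one entry since the set of entries is bounded. *)
have -> : b `^ (p / 2) = (b `^ 2^-1) `^ p by rewrite mulrC powRrM.
apply: ge0_ler_powR; rewrite ?nnegrE ?powR_ge0//; first lra.
  apply: (@le_trans _ _ _ _ _ (powR_ge0 _ _)); apply: ub_le_sup.
    by exists (b `^ 2^-1).
  by exists (x0, x0).
by apply: ge_sup norm_ub; eexists; exists (x0, x0).
Qed.
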